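(* Let $T$ be an ergodic automorphism with discrete spectrum, realized as an ergodic translation $Tx=x+g$ on a compact abelian group $G$ with normalized Haar measure $m$, and let $\rho$ be either a bounded admissible metric on $(G,m)$ or, more generally, an admissible metric for which the average metric $\hat\rho^T$ is admissible. Then the scaling sequence for $T$ and $\rho$ is bounded, i.e. for every $\varepsilon>0$ the sequence $n\mapsto H_{\hat\rho_n,\varepsilon}(m)$ is bounded.
   Context: $\hat\rho_n(x,y)=\frac1n\sum_{k=0}^{n-1}\rho(T^kx,T^ky)$ and $\hat\rho^T=\lim_n\hat\rho_n$ (a.e.). A measurable $\rho$ is an admissible metric if (1) it is a metric in the usual sense on a set of full measure and $\int\int\rho\,dm\,dm<\infty$, and (2) the completion of $(G,\rho)$ is a Polish space on which $m$ is a Borel probability measure (the Borel $\sigma$-algebra being dense mod $0$ in the measurable $\sigma$-algebra). For an admissible (semi)metric $\theta$, $H_{\theta,\varepsilon}(m)=\inf\{H(\nu):k_\theta(\nu,m)<\varepsilon\}$, where $\nu=\sum_ic_i\delta_{x_i}$ ranges over discrete measures with finite entropy $H(\nu)=-\sum_ic_i\ln c_i$ and $k_\theta$ is the Kantorovich (transportation) metric for the cost $\theta$. The class of scaling sequences for $T,\rho,\varepsilon$ is the set of increasing positive sequences $(c_n)$ with $0<\liminf_n H_{\hat\rho_n,\varepsilon}(m)/c_n\le\limsup_n H_{\hat\rho_n,\varepsilon}(m)/c_n<\infty$; ''the scaling sequence is bounded'' means these entropies stay bounded in $n$. *)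

(* Defs.v *)
From HB Require Import structures.
From mathcomp Require Import all_boot all_order all_algebra.
From mathcomp Require Import all_classical all_reals all_analysis.
Set Implicit Arguments. Unset Strict Implicit. Unset Printing Implicit Defensive.
Import Order.TTheory GRing.Theory Num.Theory numFieldNormedType.Exports.
Local Open Scope classical_set_scope.
Local Open Scope ring_scope.

Definition gpt (G : topologicalZmodType) : Type := G.
HB.instance Definition _ (G : topologicalZmodType) := Choice.on (gpt G).
HB.instance Definition _ (G : topologicalZmodType) :=
  isPointed.Build (gpt G) (GRing.zero : G).
Notation Borel G := (@g_sigma_algebraType (gpt G) (@open G)).

Section Defs.
Context {R : realType} {G : topologicalZmodType}.
Local Notation GB := (Borel G).

(* m is the normalized Haar measure: translation invariant, and (being a
   Radon measure) inner regular by compact sets. *)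
Definition haar (m : probability GB R) : Prop :=
  (forall (a : G) (A : set GB), measurable A ->
     m ((fun x : G => x + a) @` A) = m A) /\
  (forall A : set GB, measurable A ->
     m A = ereal_sup [set m (K : set GB) | K in [set K : set G | compact K /\ K `<=` A]]).

Definition transl (g : G) : G -> G := fun x => x + g.

Definition ergodic_translation (m : probability GB R) (g : G) : Prop :=
  forall A : set GB, measurable A -> transl g @^-1` A = A ->
    m A = 0%E \/ m A = 1%E.

Definition rho_hat (g : G) (rho : G -> G -> R) (n : nat) : G -> G -> R :=
  fun x y => n%:R^-1 * \sum_(k < n) rho (iter k (transl g) x) (iter k (transl g) y).

Definition is_metric_on (X : set G) (rho : G -> G -> R) : Prop :=
  (forall x y, X x -> X y -> (rho x y = 0 <-> x = y)) /\
  (forall x y, X x -> X y -> rho x y = rho y x) /\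
  (forall x y z, X x -> X y -> X z -> rho x z <= rho x y + rho y z).

Definition rho_balls (X : set G) (rho : G -> G -> R) : set (set G) :=
  [set B | exists x r, X x /\ 0 < r /\ B = [set y | X y /\ rho x y < r]].

(* Admissibility of rho, witnessed by the full-measure set X:
   (1) rho is measurable, a metric on X, m(X)=1, and int int |rho| dm dm < oo;
   (2) the completion of (X, rho) is Polish (equivalently (X, rho) is
       separable) and m is a Borel measure on it (rho-balls are measurable),
       the rho-Borel sigma-algebra being dense mod 0 in the measurable
       sigma-algebra. *)
Definition admissible_on (m : probability GB R) (rho : G -> G -> R) (X : set GB) : Prop :=
  [/\ measurable X, m X = 1%E,
      measurable_fun [set: GB * GB] (fun p : GB * GB => rho p.1 p.2),
      is_metric_on X rho &
      (\int[m]_x \int[m]_y (`|rho x y|)%:E < +oo)%E] /\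
  [/\ (exists d : nat -> G, (forall n, X (d n)) /\
         forall x, X x -> forall e, 0 < e -> exists n, rho x (d n) < e),
      (forall B, rho_balls X rho B -> measurable (B : set GB)) &
      (forall A : set GB, measurable A -> exists B : set GB,
          <<s rho_balls X rho >> B /\ measurable B /\
          m ((A `\` B) `|` (B `\` A)) = 0%E)].

Definition admissible (m : probability GB R) (rho : G -> G -> R) : Prop :=
  exists X, admissible_on m rho X.

Definition bounded_admissible (m : probability GB R) (rho : G -> G -> R) : Prop :=
  exists X C, admissible_on m rho X /\
    forall x y, X x -> X y -> rho x y <= C.

Definition average_limit (m : probability GB R) (g : G) (rho rhoT : G -> G -> R) : Prop :=
  {ae (m \x m)%E, forall p : GB * GB,
     ((fun n : nat => rho_hat g rho n.+1 p.1 p.2) : R^nat) @ \oo --> (rhoT p.1 p.2 : R)}.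

(* A discrete probability measure nu = sum_i c_i delta_{x_i} (distinct atoms) *)
Definition discrete_prob (x : nat -> G) (c : nat -> R) : Prop :=
  (forall i, 0 <= c i) /\
  (\sum_(0 <= i <oo) (c i)%:E = 1)%E /\
  (forall i j, 0 < c i -> 0 < c j -> x i = x j -> i = j).

Definition discrete_meas (x : nat -> G) (c : nat -> R) (A : set G) : \bar R :=
  (\sum_(0 <= i <oo) ((c i)%:E * (\1_A (x i))%:E))%E.

Definition entropy (c : nat -> R) : \bar R :=
  (\sum_(0 <= i <oo) (- (c i * ln (c i)))%:E)%E.

Definition coupling (nu : set G -> \bar R) (m : probability GB R)
  (gam : probability (GB * GB)%type R) : Prop :=
  forall A : set GB, measurable A ->
    gam (A `*` [set: GB]) = nu A /\ gam ([set: GB] `*` A) = m A.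

Definition kantorovich (theta : G -> G -> R) (nu : set G -> \bar R)
  (m : probability GB R) : \bar R :=
  ereal_inf [set (\int[gam]_p (theta p.1 p.2)%:E)%E
            | gam in [set gam | coupling nu m gam]].

Definition eps_entropy (theta : G -> G -> R) (eps : R) (m : probability GB R) : \bar R :=
  ereal_inf [set entropy c | c in
    [set c | exists x, discrete_prob x c /\ (entropy c < +oo)%E /\
             (kantorovich theta (discrete_meas x c) m < eps%:E)%E]].

End Defs.

(* Main.v *)
Require Import Defs.
From HB Require Import structures.
From mathcomp Require Import all_boot all_order all_algebra.
From mathcomp Require Import all_classical all_reals all_analysis.
From mathcomp Require Import measurable_realfun lra.
Import Order.TTheory GRing.Theory Num.Theory numFieldNormedType.Exports.
Local Open Scope classical_set_scope.
Local Open Scope ring_scope.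
Set Implicit Arguments.
Unset Strict Implicit.

(* Separability of rho, inner regularity of m and compactness show that rho is
   almost controlled by the topology: for every e > 0 there are a neighbourhood
   U of 0 and u >= 0 with integral at most e such that
     rho x y <= e + u x + u y    whenever x - y lies in U.
   The condition on x - y and the integral of u are translation invariant, so
   the same inequality holds for the averaged metric rho_hat n with u replaced
   by its orbit average u_n, whose integral is still at most e.  A finite
   partition of G into U-small cells, chosen independently of n, then
   discretizes m: move each cell to a point almost minimizing u_n in it.  The
   transport cost is at most the integral of 2 e + 2 u_n, and the entropy is at
   most the number of cells. *)

(** * Superlevel sets and tails of integrals *)

Lemma measurable_superlevel (d : measure_display) (T : measurableType d)
    (R : realType) (f : T -> R) (C : R) :
  measurable_fun setT f -> measurable [set y | C < f y].
Proof.
move=> mf; rewrite (_ : [set y | _] = setT `&` f @^-1` `]C, +oo[%classic).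
  exact: mf.
by rewrite setTI; apply/seteqP; split => y /=; rewrite in_itv/= andbT.
Qed.

(** Dominated convergence: the truncations [F n] tend to 0 pointwise under the integrable bound [f],
    so some natural number serves as [C]. *)
Lemma integral_tail_small (d : measure_display) (T : measurableType d)
    (R : realType) (mu : {measure set T -> \bar R}) (f : T -> R) (e : R) :
  measurable_fun setT f -> (forall x, 0 <= f x) ->
  (\int[mu]_x (f x)%:E < +oo)%E -> 0 < e ->
  exists2 C : R, 0 <= C &
    (\int[mu]_x (f x * \1_[set y | C < f y] x)%:E <= e%:E)%E.
Proof.
move=> mf f0 intf e0.
have mlt n : measurable [set y | (n%:R : R) < f y].
  exact: measurable_superlevel.
pose F n x : \bar R := (f x * \1_[set y | n%:R < f y] x)%:E.
have mF n : measurable_fun setT (F n).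
  by apply/measurable_EFinP; apply: measurable_funM => //; exact: measurable_indic.
have Fcvg x : F n x @[n --> \oo] --> (cst 0%E : T -> \bar R) x.
  apply: cvg_near_cst; exists (Num.trunc (f x)).+1 => // n /= hn.
  rewrite /F indicE memNset ?mulr0//= => /lt_geF/negP; apply.
  have := truncnS_gt (f x) => /ltW/le_trans; apply.
  by rewrite ler_nat.
have intF : mu.-integrable setT (EFin \o f).
  apply/integrableP; split; first exact/measurable_EFinP.
  by under eq_integral do rewrite /= ger0_norm//.
have Fle n x : (`|F n x| <= (EFin \o f) x)%E.
  rewrite /F /= lee_fin indicE normrM (ger0_norm (f0 x)) ger0_norm//.
  by case: (_ \in _); rewrite ?mulr1 ?mulr0.
have := @dominated_cvg _ _ _ mu _ measurableT F (cst 0%E) (EFin \o f) mF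
  (fun x _ => Fcvg x) (fun _ _ => isT) intF (fun n x _ => Fle n x).
rewrite integral0 => /(_ [set y | (y < e%:E)%E]) [].
  by apply: open_nbhs_nbhs; split; [exact: open_ereal_lt_ereal|rewrite /= lte_fin].
move=> n _ /(_ n (leqnn n)) /ltW Fn.
by exists n%:R.
Qed.

(** * Borel sets, translations and invariance of the Haar measure *)

Section translation.
Context {R : realType} {G : topologicalZmodType}.
Local Notation GB := (Borel G).
Implicit Types (m : probability GB R) (a g : G).

Lemma measurable_open (U : set G) : open U -> measurable (U : set GB).
Proof. by move=> oU; apply: sub_sigma_algebra. Qed.

Lemma measurable_closed (U : set G) : closed U -> measurable (U : set GB).
Proof.
move=> cU; rewrite -[U]setCK; apply: measurableC; apply: measurable_open.
by rewrite openC.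
Qed.

Lemma continuous_translate a : continuous (fun x : G => x + a).
Proof.
move=> x; apply: (@continuous_comp _ _ _ (fun y => (y, a))
  (fun p : G * G => p.1 + p.2)).
  by apply: cvg_pair => /=; [exact: cvg_id|exact: cvg_cst].
exact: add_continuous.
Qed.

Lemma measurable_translate a :
  measurable_fun [set: GB] (fun x : GB => (x + a : G) : GB).
Proof.
apply: (@measurability _ _ GB GB setT _ (@open G : set (set GB)) erefl).
move=> _ [B oB <-]; rewrite setTI.
by apply: measurable_open; apply: open_comp => // x _; exact: continuous_translate.
Qed.

Lemma haar_preimage m a (A : set GB) : haar m -> measurable A ->
  m ((fun x : G => x + a) @^-1` A) = m A.
Proof.
move=> [inv _] mA; rewrite -(inv (- a) _ mA); congr (m _).
apply/seteqP; split => [x /= Ax|_ [x Ax <-] /=]; last by rewrite subrK.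
by exists (x + a) => //; rewrite addrK.
Qed.

Lemma haar_integral m a (u : G -> R) : haar m ->
  measurable_fun [set: GB] (u : GB -> R) -> (forall x, 0 <= u x) ->
  (\int[m]_x (u (x + a))%:E = \int[m]_x (u x)%:E)%E.
Proof.
move=> hm mu u0.
have mu' : measurable_fun [set: GB] (EFin \o (u : GB -> R)) by apply/measurable_EFinP.
have := @ge0_integral_pushforward _ _ _ _ _ _
  (measurable_translate a) m setT (EFin \o u) measurableT mu'.
rewrite preimage_setT => <-; last by move=> y _; rewrite lee_fin.
apply: eq_measure_integral; first exact: measurable_translate.
by move=> ? A mA _; exact: haar_preimage.
Qed.

End translation.

(* [compact_cover] is stated for pointed topological spaces only. *)
HB.instance Definition _ (G : topologicalZmodType) := Topological.on (gpt G).

(** * Separation and small partitions in a compact group *)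

Section group_topology.
Context {G : topologicalZmodType}.
Local Notation GB := (Borel G).

(** For distinct indices the difference set of [K i] and [K j] is compact, hence closed, and misses
    0 by disjointness. [U] is the complement of the finite union of these sets. *)
Lemma disjoint_compacts_separated (K : nat -> set G) (J : nat) :
  hausdorff_space G -> (forall j, compact (K j)) -> trivIset setT K ->
  exists U : set G, [/\ open U, U 0 & forall i j x y,
    (i < J)%N -> (j < J)%N -> K i x -> K j y -> U (x - y) -> i = j].
Proof.
move=> hG cK tK.
pose sub (p : G * G) := p.1 - p.2.
pose D := [set p : nat * nat | [/\ (p.1 < J)%N, (p.2 < J)%N & p.1 != p.2]].
pose F (p : nat * nat) := sub @` (K p.1 `*` K p.2).
exists (~` \bigcup_(p in D) F p); split.
- rewrite openC; apply: closed_bigcup => [|p _].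
    apply: (@sub_finite_set _ _ (`I_J `*` `I_J)); first by move=> p [].
    by apply: finite_setX; exact: finite_II.
  apply: compact_closed => //; apply: continuous_compact.
    exact/continuous_subspaceT/sub_continuous.
  exact: compact_setX.
- move=> [[i j] [_ _ /= ij] [[x y] [/= Kx Ky]]] /subr0_eq /= xy.
  move/eqP: ij; apply; apply: tK => //; exists x; split => //.
  by rewrite xy.
- move=> i j x y iJ jJ Kx Ky nF; apply: contrapT => /eqP ij.
  by apply: nF; exists (i, j) => //; exists (x, y).
Qed.

Lemma open_half (U : set G) : open U -> U 0 ->
  exists V : set G, [/\ open V, V 0 & forall x y, V x -> V y -> U (x - y)].
Proof.
move=> oU U0.
have : nbhs ((0 : G, 0 : G)) ((fun p : G * G => p.1 - p.2) @^-1` U).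
  apply: (@sub_continuous G); apply: open_nbhs_nbhs; split => //=.
  by rewrite subr0.
case=> -[P Q] /= [nP nQ] PQ.
exists ((P `&` Q)^°); split; first exact: open_interior.
- by rewrite interiorI.
- move=> x y /interior_subset [Px _] /interior_subset [_ Qy].
  exact: (PQ (x, y)).
Qed.

(** By compactness finitely many translates of a half-size neighbourhood [V] cover the group; making
    them disjoint gives the cells. Padding with empty sets turns the finite list into a sequence. *)
Lemma small_measurable_partition (U : set G) :
  compact [set: G] -> open U -> U 0 ->
  exists (N : nat) (A : nat -> set GB),
    [/\ forall i, measurable (A i), trivIset setT A,
        forall y, exists i, A i y, forall i, (N <= i)%N -> A i = set0 &
        forall i (x y : G), A i x -> A i y -> U (x - y)].
Proof.
move=> cG oU U0; have [V [oV V0 VU]] := open_half oU U0.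
pose f (a : gpt G) : set (gpt G) := [set x | V ((x : G) + (- (a : G)))].
have of_ (a : gpt G) : open (f a).
  apply: (@open_comp G G (fun x : G => x - a)) => // x _; exact: continuous_translate.
have cG' : @compact (gpt G) setT by [].
move: cG'; rewrite compact_cover => /(_ (gpt G) setT f (fun a _ => of_ a)) [].
  by move=> x _; exists x => //; rewrite /f /= subrr.
move=> D' _ cov; pose s := finmap.enum_fset D'.
pose F i : set GB := if (i < size s)%N then f (nth 0 s i) else set0.
exists (size s), (seqDU F); split.
- move=> i; apply: seqDU_measurable => {}i; rewrite /F; case: ifP => // _.
  exact: measurable_open.
- exact: trivIset_seqDU.
- move=> y; have [a /= aD fa] := cov y I.
  have : (\bigcup_k F k) y.
    exists (index a s) => //; rewrite /F index_mem; have -> : a \in s by [].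
    by rewrite nth_index.
  by rewrite seqDU_bigcup_eq => -[i _ Ai]; exists i.
- move=> i si; apply/seteqP; split => // y Ay.
  by have := subset_seqDU Ay; rewrite /F ltnNge si.
- move=> i x y Ax Ay; have := subset_seqDU Ax; have := subset_seqDU Ay; rewrite /F.
  case: ifP => // _ Vy Vx.
  (* Both points lie in the same translate of [V], and differences of elements of [V] lie in [U]. *)
  have -> : x - y = (x - nth 0 s i) - (y - nth 0 s i) by rewrite opprB addrA subrK.
  exact: VU.
Qed.

End group_topology.

(** * Comparison of the metric with the group topology *)

Section compact_approximation.
Context {R : realType} {G : topologicalZmodType}.
Local Notation GB := (Borel G).
Implicit Types (m : probability GB R).

Lemma haar_inner_compact m (A : set GB) (e : R) : haar m -> measurable A ->
  0 < e -> exists K : set G, [/\ compact K, K `<=` A &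
    (m A <= m (K : set GB) + e%:E)%E].
Proof.
move=> [_ reg] mA e0.
have [|x [K [cK KA] <-]] := @ub_ereal_sup_adherent _ _ e e0 (_ : ereal_sup
  [set m (K : set GB) | K in [set K : set G | compact K /\ K `<=` A]] \is a fin_num).
  by rewrite -(reg _ mA) fin_num_measure.
by rewrite -(reg _ mA) lteBlDr// => /ltW; exists K.
Qed.

(** After the [B j] are made disjoint, finitely many pieces carry all but [e / 2] of the mass, and
    inner regularity fits a compact set into each with total loss at most [e / 2]. *)
Lemma disjoint_compact_approximation m (X : set GB) (B : nat -> set GB) (e : R) :
  hausdorff_space G -> haar m -> (forall j, measurable (B j)) ->
  measurable X -> m X = 1%E -> X `<=` \bigcup_j B j -> 0 < e ->
  exists (J : nat) (K : nat -> set G),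
    [/\ forall j, compact (K j), trivIset setT K, forall j, K j `<=` B j &
        (m (~` \big[setU/set0]_(j < J) (K j : set GB)) <= e%:E)%E].
Proof.
move=> hG hm mB mX mX1 XB e0.
pose D := seqDU B.
have mD j : measurable (D j) by exact: seqDU_measurable.
have tD : trivIset setT D by exact: trivIset_seqDU.
have sumD : (\sum_(0 <= j <oo) m (D j) = 1)%E.
  rewrite -measure_semi_bigcup//; last exact: bigcup_measurable.
  apply/eqP; rewrite eq_le probability_le1/=; last exact: bigcup_measurable.
  rewrite -seqDU_bigcup_eq -mX1; apply: le_measure => //; rewrite inE//.
  exact: bigcup_measurable.
have [J ltJ] : exists J, (1 - (e / 2)%:E < \sum_(0 <= j < J) m (D j))%E.
  have : ((\sum_(0 <= j < n) m (D j))%E @[n --> \oo] --> (1%E : \bar R)).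
    by rewrite -sumD; apply: is_cvg_nneseries => *; exact: measure_ge0.
  move=> /(_ [set y | (1 - (e / 2)%:E < y)%E]) [].
    apply: open_nbhs_nbhs; split; first exact: open_ereal_gt_ereal.
    by rewrite /= -EFinB lte_fin; lra.
  by move=> J _ /(_ J (leqnn J)); exists J.
(* The loss allowed per piece; [J.+1] keeps the denominator positive when [J] is 0. *)
pose d := e / 2 / J.+1%:R.
have d0 : 0 < d by rewrite divr_gt0// ?ltr0n//; lra.
have [K HK] := choice (fun j => haar_inner_compact hm (mD j) d0).
have cK j : compact (K j) by have [] := HK j.
have KD j : K j `<=` D j by have [] := HK j.
have mK j : measurable (K j : set GB).
  by apply: measurable_closed; exact: compact_closed.
have tK : trivIset setT K.
  by move=> i j _ _ [x [Ki Kj]]; apply: tD => //; exists x; split; exact: KD.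
exists J, K; split => //.
  by move=> j; apply: subset_trans (KD j) _; exact: subset_seqDU.
rewrite probability_setC; last exact: bigsetU_measurable.
rewrite measure_bigsetU//.
have Sfin : (\sum_(i < J) m (K i : set GB))%E \is a fin_num.
  by apply/sum_fin_numP => i _ _; exact: fin_num_measure.
rewrite leeBlDr// addeC.
have le1 : (\sum_(0 <= j < J) m (D j) <= \sum_(i < J) m (K i : set GB) + (e / 2)%:E)%E.
  rewrite big_mkord.
  apply: (@le_trans _ _ (\sum_(i < J) (m (K i : set GB) + d%:E))%E).
    by apply: lee_sum => i _; have [] := HK i.
  rewrite big_split/= leeD2l// sumEFin lee_fin sumr_const card_ord -[d *+ J]mulr_natr.
  by rewrite /d mulrAC ler_pdivrMr ?ltr0n// ler_wpM2l ?ler_nat//; lra.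
move: (lt_le_trans ltJ le1); rewrite lteBlDr// -addeA -EFinD.
by rewrite -splitr => /ltW.
Qed.

(* Outside a set of small measure, points close in the group topology are
   rho-close, because the compact pieces of distinct rho-balls are separated;
   on the exceptional set the bound by the distances to [x0] takes over. *)
Lemma metric_close_up_to_small_integral m (rho : G -> G -> R) (X : set GB) (e : R) :
  hausdorff_space G -> haar m -> admissible_on m rho X -> 0 < e ->
  exists (U : set G) (u : G -> R),
    [/\ open U /\ U 0, measurable_fun [set: GB] (u : GB -> R),
        forall x, 0 <= u x, (\int[m]_x (u x)%:E <= e%:E)%E &
        forall x y : G, X x -> X y -> U (x - y) -> rho x y <= e + u x + u y].
Proof.
move=> hG hm [[mX mX1 mrho [rho0 [rhoC rhoT]] irho] [[d [dX dense]] mballs _]] e0.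
have rho_ge0 x y : X x -> X y -> 0 <= rho x y.
  move=> Xx Xy; have := rhoT x y x Xx Xy Xx.
  by rewrite (rhoC y x)// (rho0 x x Xx Xx).2//; lra.
have mabs : measurable_fun [set: GB * GB] (fun p : GB * GB => (`|rho p.1 p.2|)%:E).
  by apply/measurable_EFinP; apply: measurableT_comp => //; exact: normr_measurable.
(* The inner integral is an integrable function of its parameter, hence finite almost everywhere,
   and [X] is not null. *)
have [x0 Xx0 fin0] : exists2 x0 : GB, X x0 & (\int[m]_y (`|rho x0 y|)%:E < +oo)%E.
  pose F := fubini_F (m : {measure set GB -> \bar R}) (fun p : GB * GB => (`|rho p.1 p.2|)%:E).
  have mF : measurable_fun setT F.
    by apply: measurable_fun_fubini_tonelli_F => // p; rewrite lee_fin.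
  have F0 x : (0 <= F x)%E by apply: integral_ge0 => y _; rewrite lee_fin.
  have iF : m.-integrable setT F.
    apply/integrableP; split => //.
    by under eq_integral do rewrite gee0_abs//.
  have [N [mN mN0 FN]] := integrable_ae measurableT iF.
  apply: contrapT => noX.
  have XN : X `<=` N.
    move=> x Xx; apply: FN => /(_ I) finF; apply: noX; exists x => //.
    by rewrite -[ltLHS]/(F x) ltey_eq finF.
  have : (m X <= m N)%E by apply: le_measure => //; rewrite inE.
  by rewrite mX1 mN0 lee_fin ler10.
pose f (y : GB) : R := `|rho x0 y|.
have mf : measurable_fun [set: GB] f.
  have : measurable_fun [set: GB] ((fun p : GB * GB => rho p.1 p.2) \o pair x0).
    by apply: measurableT_comp mrho _; exact: pair1_measurable.
  by move=> h; apply: measurableT_comp h; exact: normr_measurable.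
(* The distance [f] to [x0] is at most [C] plus a tail [t] whose integral takes half of the budget
   [e]. *)
have [|C C0 tailC] := @integral_tail_small _ _ _ m f (e / 2) mf (fun _ => normr_ge0 _) fin0.
  lra.
(* Radius [e / 2] makes any two points of one ball [e]-close. *)
pose B j : set GB := [set y : GB | X y /\ rho (d j) y < e / 2].
have mB j : measurable (B j).
  by apply: mballs; exists (d j), (e / 2); split; [exact: dX|split => //; lra].
(* Chosen so that [2 * C * eta] is at most [e / 2]; adding 1 to [C] covers the case where [C] is
   0. *)
pose eta := e / 2 / (2 * (C + 1)).
have eta0 : 0 < eta by rewrite divr_gt0//; lra.
have XB : X `<=` \bigcup_j B j.
  move=> x Xx; have [|j dj] := dense x Xx (e / 2); first lra.
  by exists j => //; split => //; rewrite rhoC.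
have [J [K [cK tK KB mL]]] :=
  disjoint_compact_approximation hG hm mB mX mX1 XB eta0.
have [U [oU U0 sepU]] := disjoint_compacts_separated J hG cK tK.
pose P : set GB := \big[setU/set0]_(j < J) (K j : set GB).
have mP : measurable P.
  apply: bigsetU_measurable => j _; apply: measurable_closed.
  exact: compact_closed.
pose t (x : GB) : R := f x * \1_[set y | C < f y] x.
have mt : measurable_fun [set: GB] t.
  apply: measurable_funM => //; apply: measurable_indic.
  exact: measurable_superlevel.
have t0 x : 0 <= t x by rewrite /t; apply: mulr_ge0; rewrite ?indicE ?ler0n ?normr_ge0.
have ft x : f x <= C + t x.
  rewrite /t indicE; case: (ltP C (f x)) => [Cf|fC].
    by rewrite mem_set// mulr1; lra.
  by rewrite memNset ?mulr0 ?addr0//= => /lt_geF; rewrite fC.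
(* If [x] or [y] lies outside [P], then [rho x y] is at most [f x + f y], hence at most
   [2 * C + t x + t y], and [v] pays for [2 * C]. *)
pose v (x : GB) : R := 2 * C * \1_(~` P) x.
have v0 x : 0 <= v x by rewrite /v mulr_ge0// ?indicE ?ler0n// mulr_ge0.
have mv : measurable_fun [set: GB] v.
  apply: measurable_funM => //; apply: measurable_indic; exact: measurableC.
exists U, (fun x => v x + t x); split => //.
- exact: measurable_funD.
- by move=> x; rewrite addr_ge0.
- under eq_integral do rewrite EFinD.
  rewrite ge0_integralD//; [|by move=> x _; rewrite lee_fin|exact/measurable_EFinP
    |by move=> x _; rewrite lee_fin|exact/measurable_EFinP].
  rewrite [e]splitr EFinD; apply: leeD => //.
  rewrite /v; under eq_integral do rewrite EFinM.
  rewrite ge0_integralZl//; [|apply/measurable_EFinP; apply: measurable_indic; exact: measurableC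
    |by rewrite lee_fin mulr_ge0].
  rewrite integral_indic//; last exact: measurableC.
  rewrite setIT.
  apply: (@le_trans _ _ ((2 * C)%:E * eta%:E)%E).
    by apply: lee_wpmul2l => //; rewrite lee_fin mulr_ge0.
  rewrite -EFinM lee_fin /eta mulrA ler_pdivrMr; last lra.
  by rewrite mulrC ler_wpM2l//; lra.
- move=> x y Xx Xy Uxy.
  have rhof : rho x y <= f x + f y.
    apply: le_trans (rhoT x x0 y Xx Xx0 Xy) _.
    by rewrite /f (rhoC x x0)// lerD// ler_norm.
  have [Px|nPx] := pselect (P x); last first.
    have vx : v x = 2 * C by rewrite /v indicE mem_set// mulr1.
    by have := ft x; have := ft y; have := v0 y; lra.
  have [Py|nPy] := pselect (P y); last first.
    have vy : v y = 2 * C by rewrite /v indicE mem_set// mulr1.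
    by have := ft x; have := ft y; have := v0 x; lra.
  (* Both points lie in compact pieces; closeness forces the pieces to coincide, so one ball
     contains both points. *)
  move: Px Py; rewrite /P -!bigcup_mkord => -[i /= iJ Kix] [j /= jJ Kjy].
  have ij := sepU _ _ _ _ iJ jJ Kix Kjy Uxy; subst j.
  have [_ Bx] := KB _ _ Kix; have [_ By] := KB _ _ Kjy.
  have := rhoT x (d i) y Xx (dX i) Xy; rewrite (rhoC x (d i))//.
  by have := v0 x; have := v0 y; have := t0 x; have := t0 y; lra.
Qed.

End compact_approximation.

(** * Entropy and transport cost of a discretization along a partition *)

Section discretization.
Context {R : realType} {G : topologicalZmodType}.
Local Notation GB := (Borel G).
Implicit Types (m : probability GB R).

Lemma entropy_term_ge0 (c : R) : 0 <= c -> c <= 1 -> 0 <= - (c * ln c).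
Proof.
by move=> c0 c1; rewrite oppr_ge0 mulr_ge0_le0// ln_le0.
Qed.

(** For positive [c], the inequality ln(1 + t) <= t at t = 1/c - 1 bounds the term by 1 - c. *)
Lemma entropy_term_le1 (c : R) : 0 <= c -> - (c * ln c) <= 1.
Proof.
rewrite le_eqVlt => /predU1P[<-|c0]; first by rewrite mul0r oppr0.
have := @le_ln1Dx _ (c^-1 - 1); rewrite addrCA subrr addr0 lnV ?posrE// => H.
have {}H : - ln c <= c^-1 - 1 by apply: H; rewrite ltrBrDr addNr invr_gt0.
rewrite -mulrN; apply: (@le_trans _ _ (c * (c^-1 - 1))).
  by rewrite ler_wpM2l// ltW.
by rewrite mulrBr mulfV ?gt_eqF// mulr1; lra.
Qed.

Lemma entropy_le_support (c : nat -> R) (N : nat) :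
  (forall i, 0 <= c i) -> (forall i, c i <= 1) ->
  (forall i, (N <= i)%N -> c i = 0) -> (entropy c <= (N%:R : R)%:E)%E.
Proof.
move=> c0 c1 cN; rewrite /entropy (nneseries_split _ N); last first.
  by move=> k _; rewrite lee_fin entropy_term_ge0.
rewrite add0n eseries0 ?adde0; last by move=> i Ni _; rewrite cN// mul0r oppr0.
rewrite big_mkord sumEFin lee_fin.
apply: (@le_trans _ _ (\sum_(i < N) 1)); last by rewrite sumr_const card_ord.
by apply: ler_sum => i _; exact: entropy_term_le1.
Qed.

Section partition.
Context (m : probability GB R) (A : nat -> set GB) (x : nat -> G) (s : GB -> GB)
  (mA : forall i, measurable (A i)) (tA : trivIset setT A)
  (covA : forall y, exists i, A i y) (sA : forall i y, A i y -> s y = x i).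

Let preimage_cells (B : set GB) :
  s @^-1` B = \bigcup_i (if x i \in B then A i else set0).
Proof.
apply/seteqP; split => [y /= By|y [i _]].
  have [i Aiy] := covA y; exists i => //.
  by rewrite -(sA Aiy) mem_set.
by case: ifPn => // xB Aiy; rewrite /= (sA Aiy); exact: set_mem.
Qed.

Lemma measurable_cell_map : measurable_fun [set: GB] s.
Proof.
move=> _ B mB; rewrite setTI preimage_cells; apply: bigcup_measurable => i _.
by case: ifP.
Qed.

(** The masses of the disjoint cells sent into [B] add up, even when several cells share an atom.
    This identifies the first marginal of the coupling in [kantorovich_cells_le]. *)
Lemma measure_preimage_cell_map (B : set GB) :
  m (s @^-1` B) = discrete_meas x (fun i => fine (m (A i))) B.
Proof.
have mc i : measurable (if x i \in B then A i else set0) by case: ifP.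
rewrite preimage_cells measure_semi_bigcup//; first last.
- exact: bigcup_measurable.
- move=> i j _ _; case: ifP => _; last by rewrite set0I => -[].
  by case: ifP => _; [exact: tA|rewrite setI0 => -[]].
apply: eq_eseriesr => i _; rewrite fineK ?fin_num_measure// indicE.
by case: ifP => _; rewrite ?mule1 ?mule0 ?measure0.
Qed.

Lemma sum_measure_cells : (\sum_(0 <= i <oo) (fine (m (A i)))%:E = 1)%E.
Proof.
rewrite -(probability_setT m).
have -> : setT = \bigcup_i A i :> set GB.
  by apply/seteqP; split => // y _; have [i] := covA y; exists i.
rewrite measure_semi_bigcup//; last exact: bigcup_measurable.
by apply: eq_eseriesr => i _; rewrite fineK ?fin_num_measure.
Qed.

(** The coupling is the law of the pair [(s y, y)], carried by the graph of [s]; its cost is the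
    integral of [theta (s y) y]. *)
Lemma kantorovich_cells_le (theta : G -> G -> R) (h : G -> R) :
  measurable_fun [set: GB * GB] (fun p : GB * GB => theta p.1 p.2) ->
  measurable_fun [set: GB] (h : GB -> R) -> (forall y, 0 <= h y) ->
  {ae m, forall y, theta (s y) y <= h y} ->
  (kantorovich theta (discrete_meas x (fun i => fine (m (A i)))) m
    <= \int[m]_y (h y)%:E)%E.
Proof.
move=> mth mh h0 th.
pose f (y : GB) : (GB * GB)%type := (s y, y).
have mf : measurable_fun setT f.
  by apply: measurable_fun_pair => //; exact: measurable_cell_map.
pose Y : {mfun GB >-> (GB * GB)%type} := mfun_Sub (mem_set mf).
have mth' : measurable_fun [set: GB * GB] (fun p : GB * GB => (theta p.1 p.2)%:E).
  exact/measurable_EFinP.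
apply: (@le_trans _ _ (\int[distribution m Y]_p (theta p.1 p.2)%:E)%E).
  apply: ereal_inf_lbound; exists (distribution m Y) => // B mB.
  rewrite -measure_preimage_cell_map; split; rewrite /distribution /pushforward; congr (m _).
    by apply/seteqP; split => y //= [].
  by apply/seteqP; split => y //= [].
(* [theta] may take negative values, so the cost is first bounded by the integral of its positive
   part, which can be pulled back along [f]. *)
rewrite integralE.
apply: (@le_trans _ _ (\int[distribution m Y]_p
    ((fun p : GB * GB => (theta p.1 p.2)%:E)^\+ p))%E).
  by rewrite geeDl// oppe_le0; apply: integral_ge0 => p _; exact: funeneg_ge0.
rewrite ge0_integral_pushforward//; last exact: measurable_funepos.
rewrite preimage_setT; apply: ae_ge0_le_integral => //.
- by move=> y _; exact: funepos_ge0.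
- exact: (measurableT_comp (measurable_funepos mth') mf).
- by move=> y _; rewrite lee_fin.
- exact/measurable_EFinP.
- apply: filterS th => y ty _.
  by rewrite /= funeposE ge_max !lee_fin ty h0.
Qed.

End partition.
End discretization.

(** * Orbit averages and the uniform entropy bound *)

Section averages.
Context {R : realType} {G : topologicalZmodType}.
Local Notation GB := (Borel G).
Implicit Types (m : probability GB R) (g : G).

Lemma iter_transl g (k : nat) (x : G) : iter k (transl g) x = x + g *+ k.
Proof.
elim: k => [|k IH]; first by rewrite mulr0n addr0.
by rewrite iterS IH /transl mulrSr addrA.
Qed.

(** The Birkhoff average of [u], the one-variable counterpart of [rho_hat]. *)
Definition orbit_average g (u : G -> R) (n : nat) (x : G) : R :=
  n%:R^-1 * \sum_(k < n) u (iter k (transl g) x).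

Lemma orbit_average_ge0 g (u : G -> R) n x :
  (forall y, 0 <= u y) -> 0 <= orbit_average g u n x.
Proof. by move=> u0; rewrite mulr_ge0 ?invr_ge0// sumr_ge0. Qed.

Lemma measurable_iter_transl g k :
  measurable_fun [set: GB] (fun x : GB => iter k (transl g) x : GB).
Proof.
rewrite (_ : (fun x => _) = (fun x : GB => (x : G) + g *+ k : GB)).
  exact: measurable_translate.
by apply/funext => x; rewrite iter_transl.
Qed.

Lemma measurable_orbit_average g (u : G -> R) n :
  measurable_fun [set: GB] (u : GB -> R) ->
  measurable_fun [set: GB] (orbit_average g u n : GB -> R).
Proof.
move=> mu; apply: measurable_funM => //; apply: measurable_sum => k.
exact: (measurableT_comp mu (measurable_iter_transl g k)).
Qed.

Lemma measurable_rho_hat g (rho : G -> G -> R) n :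
  measurable_fun [set: GB * GB] (fun p : GB * GB => rho p.1 p.2) ->
  measurable_fun [set: GB * GB] (fun p : GB * GB => rho_hat g rho n p.1 p.2).
Proof.
move=> mrho; apply: measurable_funM => //; apply: measurable_sum => k.
apply: (measurableT_comp mrho (g := fun p : GB * GB =>
  (iter k (transl g) p.1 : GB, iter k (transl g) p.2 : GB))).
apply: measurable_fun_pair.
- exact: (measurableT_comp (measurable_iter_transl g k) measurable_fst).
- exact: (measurableT_comp (measurable_iter_transl g k) measurable_snd).
Qed.

(** Every summand has the integral of [u] by invariance; positivity of [n] lets the factor 1/n
    cancel the number of summands. *)
Lemma integral_orbit_average m g (u : G -> R) n : haar m ->
  measurable_fun [set: GB] (u : GB -> R) -> (forall x, 0 <= u x) -> (0 < n)%N ->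
  (\int[m]_x (orbit_average g u n x)%:E = \int[m]_x (u x)%:E)%E.
Proof.
move=> hm mu u0 n0.
have mk k : measurable_fun [set: GB] (fun x : GB => (u (iter k (transl g) x))%:E).
  by apply/measurable_EFinP; exact: (measurableT_comp mu (measurable_iter_transl g k)).
rewrite /orbit_average; under eq_integral do rewrite EFinM -sumEFin.
rewrite ge0_integralZl//; first last.
- by move=> x _; apply: sume_ge0 => k _; rewrite lee_fin.
- exact: emeasurable_sum.
rewrite ge0_integral_sum//; last by move=> k x _; rewrite lee_fin.
rewrite (eq_bigr (fun=> (\int[m]_x (u x)%:E)%E)); last first.
  move=> k _; rewrite -(haar_integral (g *+ k) hm mu u0).
  by apply: eq_integral => x _; rewrite iter_transl.
rewrite sumr_const card_ord -[X in (_ * X)%E]mule_natl muleA -EFinM mulVf ?mul1e//.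
by rewrite pnatr_eq0 -lt0n.
Qed.

(** The exceptional set is a countable union of translates of the null complement of [X]. *)
Lemma haar_full_orbit m g (X : set GB) : haar m -> measurable X -> m X = 1%E ->
  {ae m, forall x, forall k, X (iter k (transl g) x)}.
Proof.
move=> hm mX mX1; pose P k : set GB := (fun x : G => x + g *+ k) @^-1` X.
have mP k : measurable (P k).
  by rewrite -[P k]setTI; exact: measurable_translate.
have mP0 k : m (~` P k) = 0%E.
  by rewrite probability_setC// haar_preimage// mX1 subee.
have : m.-negligible (\bigcup_k ~` P k).
  apply: negligible_bigcup => k; exists (~` P k); split => //.
  - exact: measurableC.
  - exact: mP0.
apply: negligibleS => x /= /existsNP[k nX]; exists k => //.
by rewrite /P /= -iter_transl.
Qed.

Lemma eps_entropy_rho_hat_bounded m g (rho : G -> G -> R) (eps : R) :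
  compact [set: G] -> hausdorff_space G -> haar m -> admissible m rho ->
  0 < eps ->
  exists M : R, forall n : nat, (0 < n)%N ->
    (eps_entropy (rho_hat g rho n) eps m <= M%:E)%E.
Proof.
(* The final cost is at most [4 * e], which must be strictly below [eps]. *)
move=> cG hG hm [X adm] eps0; pose e := eps / 5.
have e0 : 0 < e by rewrite /e; lra.
have [U [u [[oU U0] mu u0 iu closeU]]] :=
  metric_close_up_to_small_integral hG hm adm e0.
have [N [A [mA tA covA AN AU]]] := small_measurable_partition cG oU U0.
case: adm => -[mX mX1 mrho _ _] _.
(* The bound is the number of cells, fixed before [n] is introduced. *)
exists N%:R => n n0.
pose un := orbit_average g u n.
have un0 y : 0 <= un y by exact: orbit_average_ge0.
pose Q := [set y : G | forall k, X (iter k (transl g) y)].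
have aeQ : {ae m, forall y, Q y} by exact: haar_full_orbit.
(* Translation preserves differences, so [closeU] applies at every time [k] and the inequalities are
   averaged. *)
have rho_le y z : Q y -> Q z -> U (y - z) -> rho_hat g rho n y z <= e + un y + un z.
  move=> Qy Qz Uyz; rewrite /rho_hat /un /orbit_average.
  have nn0 : 0 < (n%:R : R) by rewrite ltr0n.
  have -> : e = n%:R^-1 * \sum_(k < n) e.
    by rewrite sumr_const card_ord -[e *+ n]mulr_natl mulKf ?gt_eqF.
  rewrite -!mulrDr ler_wpM2l ?invr_ge0 ?(ltW nn0)// -!big_split/=.
  apply: ler_sum => k _; apply: closeU => //.
  by rewrite !iter_transl opprD addrACA subrr addr0.
(* The atom nearly minimizes [un] on the part of the cell in [Q]; a cell missing [Q] is null and
   gets the dummy atom 0. *)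
have atom i : exists xi : G, A i `&` Q !=set0 ->
    [/\ A i xi, Q xi & forall y, A i y -> Q y -> un xi <= un y + e].
  have [AQ|nAQ] := pselect (A i `&` Q !=set0); last by exists 0.
  have hi : has_inf [set un y | y in A i `&` Q].
    by split; [exact: image_nonempty|exists 0 => _ [y _ <-]].
  have [_ [xi [Axi Qxi] <-] lt_xi] := inf_adherent e0 hi.
  exists xi => _; split => // y Ay Qy; apply: le_trans (ltW lt_xi) _.
  by rewrite lerD2r; apply: (inf_lbound hi.2); exists y.
have [x Hx] := choice atom.
have [idx Hidx] := choice covA.
pose s (y : GB) : GB := x (idx y).
have sA i y : A i y -> s y = x i.
  move=> Ay; rewrite /s; congr x; apply: tA => //; exists y; split => //.
pose c i := fine (m (A i)).
have cE i : (c i)%:E = m (A i) by rewrite fineK ?fin_num_measure.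
have c0 i : 0 <= c i by rewrite -lee_fin cE.
have c1 i : c i <= 1 by rewrite -lee_fin cE; exact: probability_le1.
have cN i : (N <= i)%N -> c i = 0 by move=> Ni; rewrite /c AN// measure0.
have entN : (entropy c <= (N%:R : R)%:E)%E by exact: entropy_le_support.
apply: le_trans entN; apply: ereal_inf_lbound; exists c => //.
exists x; split; [split => //; split|split].
- exact: sum_measure_cells.
(* A cell of positive mass meets the full-measure set [Q], so its atom lies in it; disjoint cells
   then have distinct atoms. *)
- have cellQ i : 0 < c i -> A i (x i).
    move=> ci; suff /Hx[] : A i `&` Q !=set0 by [].
    apply: contrapT => nAQ; move: ci; rewrite -lte_fin cE.
    suff -> : m (A i) = 0%E by rewrite ltxx.
    case: aeQ => N' [mN' mN'0 QN']; apply: (subset_measure0 _ mN' _ mN'0) => //.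
    by move=> y Ay; apply: QN' => Qy; apply: nAQ; exists y.
  move=> i j ci cj xij; apply: tA => //; exists (x i); split; first exact: cellQ.
  by rewrite xij; exact: cellQ.
- by apply: le_lt_trans (entropy_le_support c0 c1 cN) _; exact: ltry.
(* For [y] in [Q] with atom [xi], the cost is at most [e + un xi + un y], and [un xi] is at most
   [un y + e]. *)
- pose h y := 2 * e + 2 * un y.
  have mun : measurable_fun [set: GB] (un : GB -> R) by exact: measurable_orbit_average.
  apply: (@le_lt_trans _ _ (\int[m]_y (h y)%:E)%E).
    apply: (@kantorovich_cells_le _ _ m A x s mA tA covA sA) => //.
    + exact: measurable_rho_hat.
    + by apply: measurable_funD => //; apply: measurable_funM.
    + by move=> y; rewrite /h addr_ge0// mulr_ge0// ltW.
    + apply: negligibleS aeQ => y; apply: contra_not => Qy.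
      have [|Ax Qx unx] := Hx (idx y); first by exists y.
      have := rho_le _ _ Qx Qy (AU _ _ _ Ax (Hidx y)).
      by have := unx _ (Hidx y) Qy; rewrite /h /s /=; lra.
  rewrite /h; under eq_integral do rewrite EFinD.
  rewrite ge0_integralD//; first last.
  - by apply/measurable_EFinP; exact: measurable_funM.
  - by move=> y _; rewrite lee_fin mulr_ge0.
  - by move=> y _; rewrite lee_fin; lra.
  under [X in (_ + X)%E]eq_integral do rewrite EFinM.
  rewrite ge0_integralZl//; first last.
  - by move=> y _; rewrite lee_fin.
  - exact/measurable_EFinP.
  rewrite integral_cst// [X in (_ * X + _)%E]probability_setT mule1 integral_orbit_average//.
  apply: (@le_lt_trans _ _ ((2 * e)%:E + 2%:E * e%:E)%E).
    by rewrite leeD2l// lee_wpmul2l.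
  by rewrite -EFinM -EFinD lte_fin /e; lra.
Qed.

End averages.

Theorem theorem5 (R : realType) (G : topologicalZmodType)
  (m : probability (Borel G) R) (g : G) (rho : G -> G -> R) :
  compact [set: G] -> hausdorff_space G ->
  haar m -> ergodic_translation m g ->
  (bounded_admissible m rho \/
   (admissible m rho /\
    exists rhoT : G -> G -> R, average_limit m g rho rhoT /\ admissible m rhoT)) ->
  forall eps : R, 0 < eps ->
    exists M : R, forall n : nat, (0 < n)%N ->
      (eps_entropy (rho_hat g rho n) eps m <= M%:E)%E.
Proof.
move=> cG hG hm _ adm eps; apply: eps_entropy_rho_hat_bounded => //.
by case: adm => [[X [C [admX _]]]|[]//]; exists X.
Qed.
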